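(* The ratio $\frac{D(G\star K_1)}{D(G)}$ can be arbitrarily small over connected graphs $G$ of order greater than $1$: for every $\varepsilon>0$ there exists a connected graph $G$ of order $n>1$ with $\frac{D(G\star K_1)}{D(G)}<\varepsilon$.
   Context: All graphs are finite and simple. The distinguishing number $D(G)$ is the least $r$ such that there is a labeling $V(G)\to\{1,\dots,r\}$ preserved by no non-identity automorphism of $G$. For a graph $G$, $G\star K_1$ is the graph obtained from $G$ by adding, for each vertex $v$ of $G$, a new vertex $K_1^{v}$ adjacent exactly to the neighbours of $v$ in $G$ (the neighbourhood corona of $G$ with $K_1$). *)

(* Defs.v *)
From HB Require Import structures.
From mathcomp Require Import all_boot all_order all_algebra all_fingroup.
From mathcomp Require Import reals.
Set Implicit Arguments.
Unset Strict Implicit.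
Unset Printing Implicit Defensive.

Record sgraph := SGraph {
  vertex :> finType;
  edge : rel vertex;
  edge_sym : symmetric edge;
  edge_irr : irreflexive edge }.

Definition graph_order (G : sgraph) : nat := #|G|.

(* The null graph satisfies this vacuously. *)
Definition graph_connected (G : sgraph) : Prop :=
  forall x y : G, connect (@edge G) x y.

Definition is_automorphism (G : sgraph) (s : {perm G}) : bool :=
  [forall x, forall y, edge (s x) (s y) == edge x y].

Definition preserves (G : sgraph) (r : nat) (c : {ffun G -> 'I_r})
    (s : {perm G}) : bool :=
  [forall x, c (s x) == c x].

Definition distinguishing (G : sgraph) (r : nat) (c : {ffun G -> 'I_r}) : bool :=
  [forall s : {perm G}, is_automorphism s && preserves c s ==> (s == 1%g)].

(* Labels are drawn from {0, ..., r-1} instead of {1, ..., r}. *)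
Definition distinguishable (G : sgraph) (r : nat) : bool :=
  [exists c : {ffun G -> 'I_r}, distinguishing c].

Lemma distinguishable_graph_order (G : sgraph) : distinguishable G (graph_order G).
Proof.
apply/existsP; exists [ffun x : G => enum_rank x].
apply/forallP=> s; apply/implyP=> /andP[_ /forallP sc].
apply/eqP/permP=> x; rewrite perm1; apply: enum_rank_inj.
by have /eqP := sc x; rewrite !ffunE.
Qed.

Lemma ex_distinguishable (G : sgraph) : exists r, distinguishable G r.
Proof. by exists (graph_order G); exact: distinguishable_graph_order. Qed.

Definition distinguishing_number (G : sgraph) : nat :=
  ex_minn (ex_distinguishable G).

(* In G * K_1, inl v is the vertex v of G and inr v is the new vertex K_1^v. *)
Definition corona_edge (G : sgraph) : rel (G + G)%type :=
  fun a b => match a, b with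
  | inl u, inl v => edge u v
  | inl u, inr v => edge v u
  | inr u, inl v => edge u v
  | inr _, inr _ => false
  end.

Lemma corona_edge_sym (G : sgraph) : symmetric (@corona_edge G).
Proof. by case=> u [] v //=; exact: edge_sym. Qed.

Lemma corona_edge_irr (G : sgraph) : irreflexive (@corona_edge G).
Proof. by case=> u //=; exact: edge_irr. Qed.

Definition neighbourhood_corona_K1 (G : sgraph) : sgraph :=
  SGraph (@corona_edge_sym G) (@corona_edge_irr G).

(* Main.v *)
Require Import Defs.
From mathcomp Require Import all_boot all_order all_algebra all_fingroup.
From mathcomp Require Import reals.
Import Order.TTheory GRing.Theory Num.Theory.
Local Open Scope ring_scope.

(**
The witness is the complete graph on m^2 vertices, with m >= 2 and 1/m < eps.
Any permutation is an automorphism of a complete graph, so a distinguishing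
labeling is injective and D(K_(m^2)) = m^2.  In the corona, an automorphism
cannot mix old and new vertices, and it permutes the pairs (v, K_1^v); giving
these m^2 pairs distinct pairs of labels needs only m labels.
*)

Lemma distinguishing_number_le (G : sgraph) (r : nat) :
  distinguishable G r -> (distinguishing_number G <= r)%N.
Proof. by rewrite /distinguishing_number; case: ex_minnP => k _; apply. Qed.

Lemma distinguishing_number_distinguishable (G : sgraph) :
  distinguishable G (distinguishing_number G).
Proof. by rewrite /distinguishing_number; case: ex_minnP. Qed.

Section CompleteGraph.
Variable T : finType.

Lemma neq_op_sym : symmetric (fun x y : T => x != y).
Proof. by move=> x y; rewrite eq_sym. Qed.

Lemma neq_op_irr : irreflexive (fun x y : T => x != y).
Proof. by move=> x; rewrite eqxx. Qed.

Definition complete_graph : sgraph := @SGraph T _ neq_op_sym neq_op_irr.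

Lemma complete_graph_connected : graph_connected complete_graph.
Proof.
move=> x y; case: (eqVneq x y) => [->|xy]; first exact: connect0.
exact: connect1.
Qed.

Lemma complete_graph_automorphism (s : {perm complete_graph}) :
  is_automorphism s.
Proof.
by apply/forallP => x; apply/forallP => y; rewrite /= (inj_eq perm_inj).
Qed.

(** The transposition of two equally labelled vertices preserves [c], so it must be the identity. *)
Lemma distinguishing_complete_graph_inj (r : nat)
    (c : {ffun complete_graph -> 'I_r}) :
  distinguishing c -> injective c.
Proof.
move=> /forallP cP x y cxy.
have /implyP := cP (tperm x y).
rewrite complete_graph_automorphism /= => tP.
have /eqP t1 : tperm x y == 1%g.
  by apply: tP; apply/forallP => z; case: tpermP => [->|->|//]; rewrite cxy.
by rewrite -(tpermL x y) t1 perm1.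
Qed.

Lemma distinguishing_number_complete_graph_ge :
  (#|T| <= distinguishing_number complete_graph)%N.
Proof.
have /existsP[c /distinguishing_complete_graph_inj c_inj] :=
  distinguishing_number_distinguishable complete_graph.
by have := leq_card c c_inj; rewrite card_ord.
Qed.

Local Notation corona := (neighbourhood_corona_K1 complete_graph).

(** An old and a new vertex are nonadjacent exactly when they have the same index. So once new
    vertices are known to go to new ones, the old vertices have to follow them. *)
Lemma corona_complete_graph_automorphism (s : {perm corona}) :
    (2 < #|T|)%N -> is_automorphism s ->
  exists f : T -> T, forall u, s (inl u) = inl (f u) /\ s (inr u) = inr (f u).
Proof.
move=> T3 /forallP sP.
have sE x y : @edge corona (s x) (s y) = @edge corona x y.
  by have /forallP/(_ y)/eqP := sP x.
(* The independent set of new vertices has more than 2 elements, whereas an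
   independent set containing the old vertex v lies in {v, K_1^v}. *)
have s_inr u : exists v, s (inr u) = inr v.
  case su: (s (inr u)) => [v|v]; last by exists v.
  have s_inr_inj : injective (fun w : T => s (inr w)).
    by move=> w1 w2 /perm_inj[].
  have card_img := card_imset predT s_inr_inj.
  have : [set s (inr w) | w in predT] \subset ([set inl v; inr v] : {set corona}).
    apply/subsetP => _ /imsetP[w _ ->].
    have := sE (inr u) (inr w); rewrite su /=; case: (s (inr w)) => z /=.
      by move/negbFE/eqP ->; rewrite !inE eqxx.
    by move/negbFE/eqP ->; rewrite !inE eqxx orbT.
  move/subset_leq_card; rewrite card_img cards2 => T2.
  by have := leq_trans T3 T2; rewrite ltnNge; case: (_ != _).
(* By [s_inr] the default value [u] never occurs. *)
pose f u := if s (inr u) is inr v then v else u.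
have s_inrE u : s (inr u) = inr (f u) by rewrite /f; have [v ->] := s_inr u.
have f_inj : injective f.
  by move=> u v fuv; have := s_inrE u; rewrite fuv -s_inrE => /perm_inj[].
exists f => u; split=> //.
have := sE (inl u) (inr u); rewrite s_inrE /= eqxx.
case su: (s (inl u)) => [v|v] /=; first by move/negbFE/eqP ->.
(* Since [f] is onto, every new vertex is already the image of a new one, so [s (inl u)] cannot be
   new. *)
have [g _ fK] := injF_bij f_inj.
by have := s_inrE (g v); rewrite fK -su => /perm_inj.
Qed.

End CompleteGraph.

Lemma distinguishable_corona_complete_graph_square (m : nat) : (1 < m)%N ->
  distinguishable
    (neighbourhood_corona_K1 (complete_graph ('I_m * 'I_m)%type)) m.
Proof.
move=> m1; apply/existsP.
(* The labels of [inl u] and [inr u] are the two coordinates of [u], so together they recover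
   [u]. *)
pose c (x : 'I_m * 'I_m + 'I_m * 'I_m) :=
  match x with inl u => u.1 | inr u => u.2 end.
exists (finfun c); apply/forallP => s; apply/implyP => /andP[s_aut /forallP sc].
have card3 : (2 < #|{: 'I_m * 'I_m}|)%N.
  by rewrite card_prod card_ord (leq_trans _ (leq_mul m1 m1)).
have [f fP] := corona_complete_graph_automorphism _ _ card3 s_aut.
have f_id u : f u = u.
  have [sl sr] := fP u.
  have /eqP := sc (inl u); have /eqP := sc (inr u); rewrite !ffunE sl sr /=.
  by move=> e2 e1; apply/eqP; rewrite -pair_eqE /pair_eq /= e1 e2 !eqxx.
by apply/eqP/permP => -[] u; rewrite perm1; have [] := fP u; rewrite f_id.
Qed.

Theorem theorem3p4 (R : realType) (eps : R) (heps : 0 < eps) :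
  exists G : sgraph,
    [/\ graph_connected G,
        (1 < graph_order G)%N &
        (distinguishing_number (neighbourhood_corona_K1 G))%:R
          / (distinguishing_number G)%:R < eps].
Proof.
(* One successor already exceeds [eps^-1]; the second ensures [1 < m]. *)
pose m := (Num.truncn eps^-1).+2.
have m_gt0 : 0 < m%:R :> R by rewrite ltr0n.
have epsV_lt : eps^-1 < m%:R.
  by apply: lt_trans (truncnS_gt _) _; rewrite ltr_nat.
pose G := complete_graph ('I_m * 'I_m)%type.
have cardG : #|{: 'I_m * 'I_m}| = (m * m)%N by rewrite card_prod card_ord.
have DG : (m * m <= distinguishing_number G)%N.
  by rewrite -cardG; exact: distinguishing_number_complete_graph_ge.
exists G; split.
- exact: complete_graph_connected.
- by rewrite /graph_order cardG (@leq_trans (2 * 2)) // leq_mul.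
have DG_gt0 : 0 < (distinguishing_number G)%:R :> R.
  by rewrite ltr0n (leq_trans _ DG).
have Dcorona : (distinguishing_number (neighbourhood_corona_K1 G) <= m)%N.
  apply: distinguishing_number_le.
  exact: distinguishable_corona_complete_graph_square.
(* With D the distinguishing number, D(corona) <= m < eps * m^2 <= eps * D(G); the strict step is 1
   < eps * m. *)
rewrite ltr_pdivrMr //; apply: (@le_lt_trans _ _ m%:R); first by rewrite ler_nat.
apply: (@lt_le_trans _ _ (eps * (m * m)%:R)); last by rewrite ler_pM2l // ler_nat.
by rewrite natrM mulrA ltr_pMl // -ltr_pdivrMl // mulr1.
Qed.
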